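(* Let $A$ be any $\mathcal C^\infty$-ring (not necessarily finitely generated), and let $B$ be a $\mathcal C^\infty$-ring (not necessarily finitely generated) that belongs to $\mathcal F$, i.e. whose natural topology with respect to the jet topology is Hausdorff. Then any $\mathbb R$-algebra morphism $\phi: A\to B$ is a $\mathcal C^\infty$-morphism, i.e. for all $n\ge 0$, all $f\in C^\infty(\mathbb R^n)$ and all $a_1,\ldots,a_n\in A$ one has $\phi(f(a_1,\ldots,a_n))=f(\phi(a_1),\ldots,\phi(a_n))$.
   Context: A $\mathcal C^\infty$-ring is a product-preserving functor to $Set$ from the category $\mathcal C^\infty$ whose objects are $\mathbb R^n$, $n\ge 0$, and whose morphisms are smooth maps; equivalently, it is a set $A$ (the value at $\mathbb R$) with an operation $f:A^n\to A$ for each smooth $f:\mathbb R^n\to\mathbb R$, compatible with composition and projections. Morphisms ($\mathcal C^\infty$-morphisms) are natural transformations, i.e. maps commuting with all these operations. Every $\mathcal C^\infty$-ring has an underlying commutative $\mathbb R$-algebra, given by the polynomial operations. Smooth functions on $\mathbb R^S$: for a set $S$ (possibly infinite), $\mathbb R^S$ is the space of functions $S\to\mathbb R$. A function $\mathbb R^S\to\mathbb R$ is smooth if it factors as a projection $\pi_F:\mathbb R^S\to\mathbb R^F$ onto a finite set $F\subseteq S$ of coordinates followed by a smooth function $\mathbb R^F\to\mathbb R$. The $\mathcal C^\infty$-ring $C^\infty(\mathbb R^S)$ of smooth functions on $\mathbb R^S$ is the free $\mathcal C^\infty$-ring generated by $S$. Hence for a $\mathcal C^\infty$-ring $A$, $h\in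 C^\infty(\mathbb R^S)$ and $\overline a\in A^S$, the element $h(\overline a)\in A$ is defined. Jet topology: $f,g\in C^\infty(\mathbb R^S)$ have the same $k$-jet at $p\in\mathbb R^S$, written $J^k_p(f)=J^k_p(g)$, if for some finite $F\subseteq S$ both factor through $\pi_F$ and the induced functions on $\mathbb R^F$ have the same $k$-jet at $\pi_F(p)$. The jet topology on $C^\infty(\mathbb R^S)$ has as a basis the empty set together with the sets $\{g\in C^\infty(\mathbb R^S) : J^{k_i}_{p_i}(g)=J^{k_i}_{p_i}(f)\text{ for all } i\}$, where $\{p_i\}$ is a finite set of points in $\mathbb R^S$, $\{k_i\}$ are non-negative integers, one for each $p_i$, and $f\in C^\infty(\mathbb R^S)$. Natural topology: the natural topology on a $\mathcal C^\infty$-ring $A$ with respect to the jet topology is the strongest (finest) topology on $A$ such that for every set $S$ and every $\overline a\in A^S$ the evaluation map $C^\infty(\mathbb R^S)\to A$, $h\mapsto h(\overline a)$, is continuous, where $C^\infty(\mathbb R^S)$ carries the jet topology. $\mathcal F$ is the full subcategory of the category of all $\mathcal C^\infty$-rings consisting of those whose natural topology with respect to the jet topology is Hausdorff (the ''near-point determined'' $\mathcal C^\infty$-rings). *)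

(* Defs.v *)
From HB Require Import structures.
From mathcomp Require Import all_boot all_order all_algebra.
From mathcomp Require Import all_classical all_reals all_analysis.
Set Implicit Arguments.
Unset Strict Implicit.
Unset Printing Implicit Defensive.
Import Order.TTheory GRing.Theory Num.Theory.
Import numFieldNormedType.Exports.
Local Open Scope classical_set_scope.
Local Open Scope ring_scope.

Section Smooth.
Variable R : realType.

Definition partial n (i : 'I_n) (f : 'rV[R]_n -> R) : 'rV[R]_n -> R :=
  fun x => 'D_('e_i) f x.

Fixpoint partials n (l : seq 'I_n) (f : 'rV[R]_n -> R) : 'rV[R]_n -> R :=
  if l is i :: l' then partials l' (partial i f) else f.

(* All iterated partial derivatives exist and are continuous. *)
Definition smooth n (f : 'rV[R]_n -> R) : Prop :=
  forall l : seq 'I_n, continuous (partials l f) /\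
    forall i x, derivable (partials l f) x ('e_i).

Definition smoothFun n := {f : 'rV[R]_n -> R | smooth f}.

Definition smooth_fun n (f : smoothFun n) : 'rV[R]_n -> R := sval f.
Coercion smooth_fun : smoothFun >-> Funclass.

Definition same_jet n (k : nat) (p : 'rV[R]_n) (f g : 'rV[R]_n -> R) : Prop :=
  forall l : seq 'I_n, (size l <= k)%N -> partials l f p = partials l g p.

Lemma partialD n (f g : 'rV[R]_n -> R) i :
  (forall x, derivable f x ('e_i)) ->
  (forall x, derivable g x ('e_i)) ->
  partial i (f \+ g) = partial i f \+ partial i g.
Proof. by move=> df dg; apply/funext => x; rewrite /partial deriveD. Qed.

Lemma partialM n (f g : 'rV[R]_n -> R) i :
  (forall x, derivable f x ('e_i)) ->
  (forall x, derivable g x ('e_i)) ->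
  partial i (f \* g) = (f \* partial i g) \+ (g \* partial i f).
Proof. by move=> df dg; apply/funext => x; rewrite /partial deriveM. Qed.

Lemma partial_cst n (c : R) (i : 'I_n) : partial i (cst c) = cst 0.
Proof. by apply/funext => x; rewrite /partial derive_cst. Qed.

Let smooth_upto n k (f : 'rV[R]_n -> R) : Prop :=
  forall l : seq 'I_n, (size l <= k)%N -> continuous (partials l f) /\
    forall i x, derivable (partials l f) x ('e_i).

Local Lemma smooth_uptoE n (f : 'rV[R]_n -> R) :
  smooth f <-> forall k, smooth_upto k f.
Proof. by split=> [sf k l _|sf l]; [exact: sf|exact: (sf (size l))]. Qed.

Local Lemma smooth_uptoW n k (f : 'rV[R]_n -> R) :
  smooth_upto k.+1 f -> smooth_upto k f.
Proof. by move=> sf l lk; apply: sf; exact: leqW. Qed.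

Local Lemma smooth_upto_partial n k (f : 'rV[R]_n -> R) i :
  smooth_upto k.+1 f -> smooth_upto k (partial i f).
Proof. by move=> sf l lk; exact: (sf (i :: l)). Qed.

Local Lemma smooth_uptoD n k (f g : 'rV[R]_n -> R) :
  smooth_upto k f -> smooth_upto k g -> smooth_upto k (f \+ g).
Proof.
elim: k f g => [|k IH] f g sf sg [|i l] lk //.
- split=> [x|i x].
    by apply: continuousD; [exact: (sf [::] _).1|exact: (sg [::] _).1].
  by apply: derivableD; [exact: (sf [::] _).2|exact: (sg [::] _).2].
- by apply: (IH f g _ _ [::]) => //; exact: smooth_uptoW.
rewrite /= partialD.
- by apply: (IH _ _ _ _ l lk); exact: smooth_upto_partial.
- by move=> x; exact: (sf [::] _).2.
- by move=> x; exact: (sg [::] _).2.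
Qed.

Local Lemma smooth_uptoM n k (f g : 'rV[R]_n -> R) :
  smooth_upto k f -> smooth_upto k g -> smooth_upto k (f \* g).
Proof.
elim: k f g => [|k IH] f g sf sg [|i l] lk //.
- split=> [x|i x].
    by apply: continuousM; [exact: (sf [::] _).1|exact: (sg [::] _).1].
  by apply: derivableM; [exact: (sf [::] _).2|exact: (sg [::] _).2].
- by apply: (IH f g _ _ [::]) => //; exact: smooth_uptoW.
rewrite /= partialM.
- suff /(_ l lk) : smooth_upto k ((f \* partial i g) \+ (g \* partial i f)) by [].
  apply: smooth_uptoD; apply: IH.
  + exact: smooth_uptoW.
  + exact: smooth_upto_partial.
  + exact: smooth_uptoW.
  + exact: smooth_upto_partial.
- by move=> x; exact: (sf [::] _).2.
- by move=> x; exact: (sg [::] _).2.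
Qed.

Lemma smoothD n (f g : 'rV[R]_n -> R) :
  smooth f -> smooth g -> smooth (f \+ g).
Proof.
move=> /smooth_uptoE sf /smooth_uptoE sg.
by apply/smooth_uptoE => k; exact: smooth_uptoD.
Qed.

Lemma smoothM n (f g : 'rV[R]_n -> R) :
  smooth f -> smooth g -> smooth (f \* g).
Proof.
move=> /smooth_uptoE sf /smooth_uptoE sg.
by apply/smooth_uptoE => k; exact: smooth_uptoM.
Qed.

Lemma smooth_cst n (c : R) : smooth (cst c : 'rV[R]_n -> R).
Proof.
move=> l; elim: l c => [|i l IH] c; last by rewrite /= partial_cst.
by split=> [x|i x]; [exact: cst_continuous|exact: derivable_cst].
Qed.

Let quotient_coord n (i j : 'I_n) (x : 'rV[R]_n) :
  (fun h : R => h^-1 *: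
    (((fun y : 'rV[R]_n => y 0 i) \o shift x) (h *: 'e_j) - x 0 i))
  @ 0^' --> ((i == j)%:R : R).
Proof.
apply: cvg_near_cst; near=> h.
have h0 : h != 0 by near: h; exact: nbhs_dnbhs_neq.
by rewrite /= !mxE eqxx /= addrK /GRing.scale /= mulrA mulVf ?mul1r.
Unshelve. all: by end_near. Qed.

Lemma smooth_coord n (i : 'I_n) : smooth (fun x : 'rV[R]_n => x 0 i).
Proof.
case=> [|j l].
  split=> [x|j x]; first exact: coord_continuous.
  by apply/cvg_ex; eexists; exact: quotient_coord.
have -> : partials (j :: l) (fun x : 'rV[R]_n => x 0 i) =
          partials l (cst ((i == j)%:R : R)).
  rewrite /=; congr (partials _ _); apply/funext => x.
  exact/cvg_lim/quotient_coord.
exact: smooth_cst.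
Qed.

(* [R^F] for a finite set [F] of indices is identified with ['rV_n] through an
   injective enumeration ['I_n -> S] of [F]; [coords s] is then the
   projection. *)
Definition coords (S : Type) n (s : 'I_n -> S) (x : S -> R) : 'rV[R]_n :=
  \row_i x (s i).

Let pull n m (u : 'I_n -> 'I_m) (x : 'rV[R]_m) : 'rV[R]_n := coords u (x 0).

Local Lemma pull_continuous n m (u : 'I_n -> 'I_m) : continuous (pull u).
Proof.
move=> x A [P Px PA].
have : nbhs x [set y : 'rV[R]_m | forall i, P 0 i (y 0 (u i))].
  have := @filter_forall _ _ (fun i (y : 'rV[R]_m) => P 0 i (y 0 (u i)))
    _ (nbhs_filter x); apply=> i.
  have /(_ (P 0 i)) := @coord_continuous R 1 m 0 (u i) x; apply.
  by have := Px 0 i; rewrite /pull mxE.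
apply: filterS => y yP; apply: PA => i j /=.
by rewrite /pull mxE (ord1 i); exact: yP.
Qed.

Local Lemma pull_line n m (u : 'I_n -> 'I_m) (x : 'rV[R]_m) h j :
  injective u ->
  pull u (h *: 'e_(u j) + x) = h *: 'e_j + pull u x.
Proof. by move=> uI; apply/rowP => k; rewrite !mxE (inj_eq uI). Qed.

Local Lemma pull_line0 n m (u : 'I_n -> 'I_m) (x : 'rV[R]_m) h i :
  i \notin codom u -> pull u (h *: 'e_i + x) = pull u x.
Proof.
move=> iu; apply/rowP => k; rewrite !mxE eqxx /=.
case: eqP => [ki|_]; last by rewrite mulr0 add0r.
by rewrite -ki codom_f in iu.
Qed.

Let quotient_pull n m (u : 'I_n -> 'I_m) (f : 'rV[R]_n -> R) x j :
  injective u ->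
  (fun h : R => h^-1 *: (((f \o pull u) \o shift x) (h *: 'e_(u j))
                          - (f \o pull u) x)) =
  (fun h : R => h^-1 *: ((f \o shift (pull u x)) (h *: 'e_j)
                          - f (pull u x))).
Proof. by move=> uI; apply/funext => h /=; rewrite pull_line. Qed.

Let quotient_pull0 n m (u : 'I_n -> 'I_m) (f : 'rV[R]_n -> R) x i :
  i \notin codom u ->
  (fun h : R => h^-1 *: (((f \o pull u) \o shift x) (h *: 'e_i)
                          - (f \o pull u) x)) = cst 0.
Proof. by move=> iu; apply/funext => h /=; rewrite pull_line0// subrr scaler0. Qed.

Local Lemma partial_pull n m (u : 'I_n -> 'I_m) (f : 'rV[R]_n -> R) j :
  injective u -> partial (u j) (f \o pull u) = partial j f \o pull u.
Proof.
by move=> uI; apply/funext => x; rewrite /partial /= /derive quotient_pull.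
Qed.

Local Lemma partial_pull0 n m (u : 'I_n -> 'I_m) (f : 'rV[R]_n -> R) i :
  i \notin codom u -> partial i (f \o pull u) = cst 0.
Proof.
move=> iu; apply/funext => x; rewrite /partial /= /derive quotient_pull0//.
exact: lim_cst.
Qed.

Local Lemma smooth_pull n m (u : 'I_n -> 'I_m) (f : 'rV[R]_n -> R) :
  injective u -> smooth f -> smooth (f \o pull u).
Proof.
move=> uI sf l; elim: l f sf => [|i l IH] f sf.
  split=> [x|i x].
    by apply: continuous_comp; [exact: pull_continuous|exact: (sf [::]).1].
  rewrite /derivable /=; have [/codomP[j ->]|iu] := boolP (i \in codom u).
    by rewrite quotient_pull//; exact: (sf [::]).2.
  by rewrite quotient_pull0//; exact: is_cvg_cst.
rewrite [partials _ _]/=; have [/codomP[j ->]|iu] := boolP (i \in codom u).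
  by rewrite partial_pull//; apply: IH => l'; exact: (sf (j :: l')).
by rewrite partial_pull0//; exact: smooth_cst.
Qed.

Local Lemma same_jet_pull n m (u : 'I_n -> 'I_m) k x (f g : 'rV[R]_n -> R) :
  injective u -> same_jet k (pull u x) f g ->
  same_jet k x (f \o pull u) (g \o pull u).
Proof.
move=> uI fg l; elim: l k f g fg => [|i l IH] k f g fg lk.
  by rewrite /=; exact: (fg [::]).
rewrite /=; have [/codomP[j ->]|iu] := boolP (i \in codom u).
  rewrite !partial_pull//; case: k fg lk => // k fg lk.
  by apply: (IH k) => // l' lk'; exact: (fg (j :: l')).
by rewrite !partial_pull0.
Qed.

End Smooth.

Section SmoothFun.
Variable R : realType.

Lemma smoothFunP n (f g : smoothFun R n) : f =1 g -> f = g.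
Proof. by case: f g => [f sf] [g sg] /= /funext fg; exact: eq_exist. Qed.

Definition sf_cst n (c : R) : smoothFun R n := exist _ _ (smooth_cst c).
Definition sf_coord n (i : 'I_n) : smoothFun R n := exist _ _ (@smooth_coord R n i).
Definition sf_add n (f g : smoothFun R n) : smoothFun R n :=
  exist _ _ (smoothD (svalP f) (svalP g)).
Definition sf_mul n (f g : smoothFun R n) : smoothFun R n :=
  exist _ _ (smoothM (svalP f) (svalP g)).
Definition sf_pull n m (u : 'I_n -> 'I_m) (uI : injective u)
    (f : smoothFun R n) : smoothFun R m :=
  exist _ _ (smooth_pull uI (svalP f)).

End SmoothFun.

(* A set with an operation for each smooth [f : R^n -> R], compatible with
   projections and composition. Composition is stated relationally: [h] is any
   smooth function equal to the composite of [f] with [(g_0, ..., g_(n-1))]. *)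
Record cinfRing (R : realType) := CinfRing {
  cinf_sort :> Type;
  cinf_op : forall n, smoothFun R n -> ('I_n -> cinf_sort) -> cinf_sort;
  cinf_op_coord : forall n (i : 'I_n) (a : 'I_n -> cinf_sort),
    cinf_op (sf_coord R i) a = a i;
  cinf_op_comp : forall n m (f : smoothFun R n) (g : 'I_n -> smoothFun R m)
      (h : smoothFun R m),
    (forall x, h x = f (\row_i g i x)) ->
    forall a : 'I_m -> cinf_sort,
      cinf_op h a = cinf_op f (fun i => cinf_op (g i) a)
}.

Definition cinf_morphism (R : realType) (A B : cinfRing R) (phi : A -> B) :=
  forall n (f : smoothFun R n) (a : 'I_n -> A),
    phi (cinf_op f a) = cinf_op f (fun i => phi (a i)).

Section UnderlyingAlgebra.
Variables (R : realType) (A : cinfRing R).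
Implicit Types (a b : A) (c : R).

Definition cinf_cst c : A := cinf_op (sf_cst 0 c) (tnth [tuple]).
Definition cinf_add a b : A :=
  cinf_op (sf_add (sf_coord R ord0) (sf_coord R ord_max)) (tnth [tuple a; b]).
Definition cinf_mul a b : A :=
  cinf_op (sf_mul (sf_coord R ord0) (sf_coord R ord_max)) (tnth [tuple a; b]).
Definition cinf_scale c a : A :=
  cinf_op (sf_mul (sf_cst 1 c) (sf_coord R ord0)) (tnth [tuple a]).

Local Lemma cinf_cstE n c (v : 'I_n -> A) : cinf_cst c = cinf_op (sf_cst n c) v.
Proof.
rewrite [RHS](@cinf_op_comp _ A 0 n (sf_cst 0 c) (tnth [tuple])) //.
by rewrite /cinf_cst; congr (cinf_op _ _); apply/funext => -[].
Qed.

Local Lemma cinf_addE n (f g : smoothFun R n) (v : 'I_n -> A) :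
  cinf_add (cinf_op f v) (cinf_op g v) = cinf_op (sf_add f g) v.
Proof.
rewrite [RHS](@cinf_op_comp _ A 2 n
  (sf_add (sf_coord R ord0) (sf_coord R ord_max)) (tnth [tuple f; g])).
  by rewrite /cinf_add; congr (cinf_op _ _); apply/funext => -[[|[|]]].
by move=> x; rewrite /smooth_fun /= !mxE.
Qed.

Local Lemma cinf_mulE n (f g : smoothFun R n) (v : 'I_n -> A) :
  cinf_mul (cinf_op f v) (cinf_op g v) = cinf_op (sf_mul f g) v.
Proof.
rewrite [RHS](@cinf_op_comp _ A 2 n
  (sf_mul (sf_coord R ord0) (sf_coord R ord_max)) (tnth [tuple f; g])).
  by rewrite /cinf_mul; congr (cinf_op _ _); apply/funext => -[[|[|]]].
by move=> x; rewrite /smooth_fun /= !mxE.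
Qed.

Local Lemma cinf_scaleE n c (f : smoothFun R n) (v : 'I_n -> A) :
  cinf_scale c (cinf_op f v) = cinf_op (sf_mul (sf_cst n c) f) v.
Proof.
rewrite [RHS](@cinf_op_comp _ A 1 n
  (sf_mul (sf_cst 1 c) (sf_coord R ord0)) (tnth [tuple f])).
  by rewrite /cinf_scale; congr (cinf_op _ _); apply/funext => -[[|]].
by move=> x; rewrite /smooth_fun /= !mxE.
Qed.

Let opE := (cinf_addE, cinf_mulE, cinf_scaleE).

Local Lemma cinf_coordE n (v : 'I_n -> A) i : v i = cinf_op (sf_coord R i) v.
Proof. by rewrite cinf_op_coord. Qed.

Let eq_op n (v : 'I_n -> A) (f g : smoothFun R n) :
  f =1 g -> cinf_op f v = cinf_op g v.
Proof. by move=> /smoothFunP ->. Qed.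

Let gen1 (P : A -> Prop) :
  (forall v : 'I_1 -> A, P (cinf_op (sf_coord R ord0) v)) -> forall a, P a.
Proof. by move=> H a; have := H (tnth [tuple a]); rewrite cinf_op_coord. Qed.

Let gen2 (P : A -> A -> Prop) :
  (forall v : 'I_2 -> A,
     P (cinf_op (sf_coord R (inord 0)) v) (cinf_op (sf_coord R (inord 1)) v)) ->
  forall a b, P a b.
Proof.
move=> H a b; have := H (tnth [tuple a; b]); rewrite !cinf_op_coord.
by rewrite !(tnth_nth a) !inordK.
Qed.

Let gen3 (P : A -> A -> A -> Prop) :
  (forall v : 'I_3 -> A, P (cinf_op (sf_coord R (inord 0)) v)
     (cinf_op (sf_coord R (inord 1)) v) (cinf_op (sf_coord R (inord 2)) v)) ->
  forall a b d, P a b d.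
Proof.
move=> H a b d; have := H (tnth [tuple a; b; d]); rewrite !cinf_op_coord.
by rewrite !(tnth_nth a) !inordK.
Qed.

Let addA : associative cinf_add.
Proof. by apply: gen3 => v; rewrite !opE; apply: eq_op => x; exact: addrA. Qed.

Let addC : commutative cinf_add.
Proof. by apply: gen2 => v; rewrite !opE; apply: eq_op => x; exact: addrC. Qed.

Let add0 : left_id (cinf_cst 0) cinf_add.
Proof.
by apply: gen1 => v; rewrite (cinf_cstE _ v) !opE; apply: eq_op => x; exact: add0r.
Qed.

Let addN : left_inverse (cinf_cst 0) (cinf_scale (-1)) cinf_add.
Proof.
apply: gen1 => v; rewrite (cinf_cstE _ v) !opE; apply: eq_op => x.
by rewrite /smooth_fun /= mulN1r addNr.
Qed.

HB.instance Definition _ := gen_eqMixin (cinf_sort A).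
HB.instance Definition _ := gen_choiceMixin (cinf_sort A).
HB.instance Definition _ :=
  GRing.isZmodule.Build (cinf_sort A) addA addC add0 addN.

Let mulA : associative cinf_mul.
Proof. by apply: gen3 => v; rewrite !opE; apply: eq_op => x; exact: mulrA. Qed.

Let mulC : commutative cinf_mul.
Proof. by apply: gen2 => v; rewrite !opE; apply: eq_op => x; exact: mulrC. Qed.

Let mul1 : left_id (cinf_cst 1) cinf_mul.
Proof.
by apply: gen1 => v; rewrite (cinf_cstE _ v) !opE; apply: eq_op => x; exact: mul1r.
Qed.

Let mulDl : left_distributive cinf_mul cinf_add.
Proof. by apply: gen3 => v; rewrite !opE; apply: eq_op => x; exact: mulrDl. Qed.

HB.instance Definition _ :=
  GRing.Zmodule_isComPzRing.Build (cinf_sort A) mulA mulC mul1 mulDl.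

Let scaleA c d a : cinf_scale c (cinf_scale d a) = cinf_scale (c * d) a.
Proof.
by move: a; apply: gen1 => v; rewrite !opE; apply: eq_op => x; exact: mulrA.
Qed.

Let scale1 : left_id 1 cinf_scale.
Proof. by apply: gen1 => v; rewrite !opE; apply: eq_op => x; exact: mul1r. Qed.

Let scaleDr : right_distributive cinf_scale cinf_add.
Proof.
by move=> c; apply: gen2 => v; rewrite !opE; apply: eq_op => x; exact: mulrDr.
Qed.

Let scaleDl a : {morph cinf_scale^~ a : c d / c + d >-> cinf_add c d}.
Proof.
move=> c d; move: a.
by apply: gen1 => v; rewrite !opE; apply: eq_op => x; exact: mulrDl.
Qed.

HB.instance Definition _ := GRing.Zmodule_isLmodule.Build R (cinf_sort A)
  scaleA scale1 scaleDr scaleDl.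

(* The library's algebra structures exclude the zero ring, so the algebra law
   is stated as a lemma on top of the ring and module structures. *)
Lemma cinf_scalerAl c a b : c *: (a * b) = c *: a * b.
Proof.
move: a b; apply: gen2 => v.
rewrite /GRing.scale /GRing.mul /= !opE.
by apply: eq_op => x; exact: mulrA.
Qed.

End UnderlyingAlgebra.

Section SmoothOnPower.
Variables (R : realType) (S : Type).

(* [h] is the projection to the finite set of coordinates enumerated by [s],
   followed by the smooth function [f]. *)
Definition factors (h : (S -> R) -> R) n (s : 'I_n -> S) (f : smoothFun R n) :=
  injective s /\ forall x, h x = f (coords s x).

Definition Cinf := {h : (S -> R) -> R |
  exists n (s : 'I_n -> S) (f : smoothFun R n), factors h s f}.

Definition Cinf_fun (h : Cinf) : (S -> R) -> R := sval h.
Coercion Cinf_fun : Cinf >-> Funclass.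

Local Lemma coords_surj n (s : 'I_n -> S) (y : 'rV[R]_n) :
  injective s -> exists x, coords s x = y.
Proof.
move=> sI.
exists (fun t => if pselect (exists i, s i = t) is left e
                 then y 0 (projT1 (cid e)) else 0).
apply/rowP => i; rewrite mxE; case: pselect => [e|[]]; last by exists i.
by congr (y _ _); apply: sI; case: cid.
Qed.

Local Lemma factors_inj h n (s : 'I_n -> S) (f g : smoothFun R n) :
  factors h s f -> factors h s g -> f = g.
Proof.
move=> [sI hf] [_ hg]; apply: smoothFunP => y.
by have [x <-] := coords_surj y sI; rewrite -hf hg.
Qed.

Local Lemma common_coords n1 n2 (s1 : 'I_n1 -> S) (s2 : 'I_n2 -> S) :
  injective s1 -> injective s2 ->
  exists m (s : 'I_m -> S) (u1 : 'I_n1 -> 'I_m) (u2 : 'I_n2 -> 'I_m),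
    [/\ injective s, injective u1, injective u2, s1 = s \o u1 & s2 = s \o u2].
Proof.
move=> s1I s2I.
pose l := undup ([seq (s1 i : {classic S}) | i <- enum 'I_n1] ++
                 [seq (s2 i : {classic S}) | i <- enum 'I_n2]).
have l1 i : (s1 i : {classic S}) \in l.
  rewrite mem_undup mem_cat; apply/orP; left; apply/mapP; exists i => //.
  by rewrite mem_enum.
have l2 i : (s2 i : {classic S}) \in l.
  rewrite mem_undup mem_cat; apply/orP; right; apply/mapP; exists i => //.
  by rewrite mem_enum.
have lt1 i : (index (s1 i : {classic S}) l < size l)%N by rewrite index_mem.
have lt2 i : (index (s2 i : {classic S}) l < size l)%N by rewrite index_mem.
pose s : 'I_(size l) -> S := tnth (in_tuple l).
have su1 : s1 = s \o (fun i => Ordinal (lt1 i)).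
  by apply/funext => i; rewrite /s /= (tnth_nth (s1 i : {classic S})) /= nth_index.
have su2 : s2 = s \o (fun i => Ordinal (lt2 i)).
  by apply/funext => i; rewrite /s /= (tnth_nth (s2 i : {classic S})) /= nth_index.
exists (size l), s, (fun i => Ordinal (lt1 i)), (fun i => Ordinal (lt2 i)).
split=> //.
- by have /tuple_uniqP : uniq (in_tuple l) by exact: undup_uniq.
- by apply: (@inj_compr _ _ _ s); rewrite -su1.
- by apply: (@inj_compr _ _ _ s); rewrite -su2.
Qed.

Local Lemma factors_pull h n m (s : 'I_m -> S) (u : 'I_n -> 'I_m)
    (uI : injective u) (f : smoothFun R n) :
  injective s -> factors h (s \o u) f -> factors h s (sf_pull uI f).
Proof.
move=> sI [_ hf]; split=> // x; rewrite hf; congr (f _).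
by apply/rowP => i; rewrite !mxE.
Qed.

Definition same_jetS (k : nat) (p : S -> R) (f g : Cinf) : Prop :=
  exists n (s : 'I_n -> S) (f' g' : smoothFun R n),
    [/\ factors f s f', factors g s g' & same_jet k (coords s p) f' g'].

Local Lemma same_jet_sf_pull n m (u : 'I_n -> 'I_m) (uI : injective u) k
    (s : 'I_m -> S) p (f g : smoothFun R n) :
  same_jet k (coords (s \o u) p) f g ->
  same_jet k (coords s p) (sf_pull uI f) (sf_pull uI g).
Proof.
move=> fg; apply: same_jet_pull => //.
by rewrite (_ : coords u _ = coords (s \o u) p)//; apply/rowP => i; rewrite !mxE.
Qed.

Lemma same_jetS_refl k p (f : Cinf) : same_jetS k p f f.
Proof. by have [n [s [f' ff']]] := svalP f; exists n, s, f', f'; split. Qed.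

Lemma same_jetS_sym k p (f g : Cinf) : same_jetS k p f g -> same_jetS k p g f.
Proof.
move=> [n [s [f' [g' [ff' gg' J]]]]]; exists n, s, g', f'; split=> // l lk.
by rewrite J.
Qed.

Lemma same_jetS_trans k p (f g h : Cinf) :
  same_jetS k p f g -> same_jetS k p g h -> same_jetS k p f h.
Proof.
move=> [n1 [s1 [f1 [g1 [ff1 gg1 J1]]]]] [n2 [s2 [g2 [h2 [gg2 hh2 J2]]]]].
have [m [s [u1 [u2 [sI u1I u2I e1 e2]]]]] := common_coords ff1.1 gg2.1.
subst s1 s2.
have g12 : sf_pull u1I g1 = sf_pull u2I g2.
  by apply: (@factors_inj g _ s); exact: factors_pull.
exists m, s, (sf_pull u1I f1), (sf_pull u2I h2).
split; [exact: factors_pull|exact: factors_pull|move=> l lk].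
by rewrite (same_jet_sf_pull u1I J1 lk) g12 (same_jet_sf_pull u2I J2 lk).
Qed.

HB.instance Definition _ := gen_eqMixin Cinf.
HB.instance Definition _ := gen_choiceMixin Cinf.

Lemma Cinf_cst_subproof (c : R) :
  exists n (s : 'I_n -> S) (f : smoothFun R n), factors (cst c) s f.
Proof. by exists 0%N, (tnth [tuple]), (sf_cst 0 c); split=> // -[]. Qed.

Definition Cinf_cst (c : R) : Cinf := exist _ _ (Cinf_cst_subproof c).

(* Points may be repeated in the family: only the largest order attached to a
   point then matters, so this gives the same basic sets as distinct points. *)
Record jet_index := JetIndex {
  jet_center : Cinf;
  jet_size : nat;
  jet_point : 'I_jet_size -> S -> R;
  jet_order : 'I_jet_size -> nat
}.

HB.instance Definition _ := gen_eqMixin jet_index.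
HB.instance Definition _ := gen_choiceMixin jet_index.
HB.instance Definition _ := isPointed.Build jet_index
  (@JetIndex (Cinf_cst 0) 0 (tnth [tuple]) (tnth [tuple])).

Definition jet_basic (i : jet_index) : set Cinf :=
  [set g | forall j : 'I_(jet_size i),
     same_jetS (jet_order j) (jet_point j) g (jet_center i)].

Local Lemma jet_basic_cover : \bigcup_(i in setT) jet_basic i = setT.
Proof.
apply/seteqP; split=> // g _.
exists (@JetIndex g 0 (tnth [tuple]) (tnth [tuple])) => // j.
exact: same_jetS_refl.
Qed.

Local Lemma jet_basic_join (i j : jet_index) (g : Cinf) :
  setT i -> setT j -> jet_basic i g -> jet_basic j g ->
  exists k, [/\ setT k, jet_basic k g & jet_basic k `<=` jet_basic i `&` jet_basic j].
Proof.
move=> _ _ ig jg.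
pose p (l : 'I_(jet_size i + jet_size j)) := match fintype.split l with
  | inl a => jet_point a | inr b => jet_point b end.
pose o (l : 'I_(jet_size i + jet_size j)) := match fintype.split l with
  | inl a => jet_order a | inr b => jet_order b end.
exists (JetIndex g p o); split=> // [l|h hg]; first exact: same_jetS_refl.
split=> l.
- apply: same_jetS_trans (ig l); have := hg (unsplit (inl l)).
  by rewrite /p /o /= (unsplitK (inl l)).
- apply: same_jetS_trans (jg l); have := hg (unsplit (inr l)).
  by rewrite /p /o /= (unsplitK (inr l)).
Qed.

(* Open sets are the unions of basic sets; the empty set, usually added to the
   basis, is the empty union. *)
HB.instance Definition _ := isBaseTopological.Build Cinf
  jet_basic_cover jet_basic_join.

Lemma jet_openE (U : set Cinf) :
  open U <-> exists D : set jet_index, U = \bigcup_(i in D) jet_basic i.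
Proof. by split=> [[D _ <-]|[D ->]]; exists D. Qed.

End SmoothOnPower.

Section NaturalTopology.
Variables (R : realType) (A : cinfRing R).

Local Lemma cinf_eval_ex S (h : Cinf R S) (a : S -> A) : exists b : A,
  exists n (s : 'I_n -> S) (f : smoothFun R n),
    factors h s f /\ b = cinf_op f (a \o s).
Proof.
have [n [s [f hf]]] := svalP h.
by exists (cinf_op f (a \o s)), n, s, f.
Qed.

(* [h(a)]; by [cinf_evalE] below, the value does not depend on the chosen
   factorization of [h]. *)
Definition cinf_eval S (a : S -> A) (h : Cinf R S) : A :=
  projT1 (cid (cinf_eval_ex h a)).

Local Lemma cinf_op_pull n m (u : 'I_n -> 'I_m) (uI : injective u)
    (f : smoothFun R n) (a : 'I_m -> A) :
  cinf_op (sf_pull uI f) a = cinf_op f (a \o u).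
Proof.
rewrite (@cinf_op_comp _ A n m f (fun i => sf_coord R (u i))).
  by congr (cinf_op _ _); apply/funext => i; rewrite cinf_op_coord.
by move=> x; congr (f _); apply/rowP => i; rewrite !mxE.
Qed.

Lemma cinf_evalE S (a : S -> A) (h : Cinf R S) n (s : 'I_n -> S)
    (f : smoothFun R n) :
  factors h s f -> cinf_eval a h = cinf_op f (a \o s).
Proof.
move=> hf; rewrite /cinf_eval; case: cid => _ /= [n' [s' [f' [hf' ->]]]].
have [m [t [u [u' [tI uI u'I e e']]]]] := common_coords hf.1 hf'.1.
subst s s'; rewrite -[a \o _]/((a \o t) \o u') -(cinf_op_pull u'I).
rewrite -[a \o (t \o u)]/((a \o t) \o u) -(cinf_op_pull uI).
by congr (cinf_op _ _); apply: (@factors_inj _ _ h _ t); exact: factors_pull.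
Qed.

Definition natural : Type := cinf_sort A.

HB.instance Definition _ := gen_eqMixin natural.
HB.instance Definition _ := gen_choiceMixin natural.

(* The natural topology with respect to the jet topology, i.e. the final
   topology for the evaluation maps [C^oo(R^S) -> A]. *)
Definition natural_open (U : set natural) : Prop :=
  forall (S : Type) (a : S -> A), open (cinf_eval a @^-1` U).

Local Lemma natural_openT : natural_open setT.
Proof. by move=> S a; rewrite preimage_setT; exact: openT. Qed.

Local Lemma natural_openI : setI_closed natural_open.
Proof. by move=> U V oU oV S a; rewrite preimage_setI; exact: openI. Qed.

Local Lemma natural_open_bigcup (I : Type) (U : I -> set natural) :
  (forall i, natural_open (U i)) -> natural_open (\bigcup_i U i).
Proof.
by move=> oU S a; rewrite preimage_bigcup; apply: bigcup_open => i _; exact: oU.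
Qed.

HB.instance Definition _ := isOpenTopological.Build natural
  natural_openT natural_openI natural_open_bigcup.

(* The next two lemmas characterize the topology above as the finest one making
   all evaluation maps continuous. *)
Lemma natural_continuous S (a : S -> A) :
  continuous (cinf_eval a : Cinf R S -> natural).
Proof. by apply/continuousP => U; apply. Qed.

Lemma natural_finest (T : topologicalType) (i : natural -> T) :
  (forall (S : Type) (a : S -> A), continuous (i \o cinf_eval a)) ->
  continuous i.
Proof.
move=> ic; apply/continuousP => U oU; suff: natural_open (i @^-1` U) by [].
by move=> S a; have /continuousP := ic S a; apply.
Qed.

End NaturalTopology.

Definition near_point_determined (R : realType) (A : cinfRing R) : Prop :=
  hausdorff_space (natural A).

(* Main.v *)
(** Both [phi] composed with the operations of [A], and the operations of [B]
    applied to the elements [phi (a i)], give ring morphisms [F] and [G] from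
    the smooth functions on [R^n] to [B], which agree on polynomials. Iterating
    Hadamard's lemma, one variable at a time, divides a smooth [f] by prescribed
    polynomials [q_i(x_i)] with all roots real, with a polynomial remainder, so
    that [F f - G f = \sum_i q_i(phi (a i)) (F g_i - G g_i)]. This element is
    the value of [\sum_i q_i(x_i) (y_i - g_i(x))] at [x_i = phi (a i)],
    [y_i = F g_i]. For finitely many given jet conditions, the roots of the
    [q_i] can be chosen with multiplicities such that this function is flat to
    the required orders at the given points. Hence every jet neighbourhood of a
    function with value [G f] contains one with value [F f]; as points of [B]
    are closed, [F f = G f]. *)
Require Import Defs.
From HB Require Import structures.
From mathcomp Require Import all_boot all_order all_algebra.
From mathcomp Require Import all_classical all_reals all_analysis.
From mathcomp Require Import ring.
Set Implicit Arguments.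
Unset Strict Implicit.
Unset Printing Implicit Defensive.
Import Order.TTheory GRing.Theory Num.Theory.
Import numFieldNormedType.Exports.
Local Open Scope classical_set_scope.
Local Open Scope ring_scope.

(** * Differentiation under the integral sign *)

Section Lines.
Variables (R : realType) (V : normedModType R).
Implicit Types (f : V -> R) (v w x y : V).

Lemma is_derive_line f y w (s : R) : derivable f (y + s *: w) w ->
  is_derive s 1 (fun r : R => f (y + r *: w)) ('D_w f (y + s *: w)).
Proof.
move=> df; have E : (fun h : R => h^-1 *: (((fun r : R => f (y + r *: w)) \o shift s)
    (h *: 1) - f (y + s *: w))) =
  (fun h : R => h^-1 *: ((f \o shift (y + s *: w)) (h *: w) - f (y + s *: w))).
  apply/funext => h /=; congr (_ *: (f _ - _)).
  by rewrite [h%:A]mulr1 scalerDl addrCA.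
by split; rewrite /derivable /derive E.
Qed.

(** Smoothness is stated through partial derivatives, so this chain rule asks only for a derivative
    along [w]: [p] maps the line along [v] affinely to a line along [w], and the one-variable chain
    rule applies. *)
Lemma is_derive_comp_line (W : normedModType R) (f : V -> R) (p : W -> V)
    (x v : W) w (c : R) :
  (forall h : R, p (h *: v + x) = p x + (c * h) *: w) ->
  derivable f (p x) w ->
  is_derive x v (f \o p) (c * 'D_w f (p x)).
Proof.
move=> px df.
have dg : is_derive (c * 0 : R) 1 (fun r : R => f (p x + r *: w)) ('D_w f (p x)).
  rewrite mulr0 -{2}[p x]addr0 -(scale0r w); apply: is_derive_line.
  by rewrite scale0r addr0.
have dc : is_derive (0 : R) 1 (fun r : R => c * r) c.
  by apply: is_derive_eq; rewrite /GRing.scale /= mulr1.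
have := @is_derive1_comp R (fun r : R => f (p x + r *: w)) (fun r : R => c * r)
  0 _ _ dg dc.
have E : (fun h : R => h^-1 *: (((f \o p) \o shift x) (h *: v) - (f \o p) x)) =
   (fun h : R => h^-1 *: ((((fun r : R => f (p x + r *: w)) \o (fun r : R => c * r))
      \o shift 0) (h *: 1) -
      ((fun r : R => f (p x + r *: w)) \o (fun r : R => c * r)) 0)).
  by apply/funext => h /=; rewrite px addr0 [h%:A]mulr1 mulr0 scale0r addr0.
move=> [d1 d2]; split; first by rewrite /derivable E.
by rewrite mulrC -[RHS]d2 /derive E.
Qed.

End Lines.

Section Slide.
Variable R : realType.

(** Homothety of centre [r] and ratio [t] in coordinate [i]: the identity at [t = 1], and at [t = 0]
    the projection onto the hyperplane where this coordinate equals [r]. *)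
Definition slide n (i : 'I_n) (r t : R) (x : 'rV[R]_n) : 'rV[R]_n :=
  x + ((t - 1) * (x 0 i - r)) *: 'e_i.

(** The factor by which [slide i r t] stretches the direction ['e_j]. *)
Definition slide_factor n (i j : 'I_n) (t : R) : R := if i == j then t else 1.

Lemma slideE n (i : 'I_n) r t x j :
  slide i r t x 0 j = if i == j then r + t * (x 0 i - r) else x 0 j.
Proof.
rewrite !mxE eqxx /= eq_sym; case: eqP => [->|_]; last by rewrite mulr0 addr0.
by rewrite mulr1; ring.
Qed.

Lemma slide1 n (i : 'I_n) r x : slide i r 1 x = x.
Proof. by rewrite /slide subrr mul0r scale0r addr0. Qed.

Lemma slide_line n (i j : 'I_n) r t x h :
  slide i r t (h *: 'e_j + x) =
  slide i r t x + (slide_factor i j t * h) *: 'e_j.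
Proof.
apply/rowP => k; rewrite slideE [RHS]mxE slideE !mxE eqxx /= /slide_factor.
have [<-|ik] := eqVneq i k; have [ij|ij] := eqVneq i j;
  rewrite ?ij /=; try ring.
by rewrite eq_sym -ij (negbTE ik) /=; ring.
Qed.

Lemma slide_continuous n (i : 'I_n) r (p : R * 'rV[R]_n) :
  {for p, continuous (fun q : R * 'rV[R]_n => slide i r q.1 q.2)}.
Proof.
apply: cvgD; first exact: cvg_snd.
apply: cvgZr_tmp; apply: cvgM.
  by apply: cvgB; [exact: cvg_fst|exact: cvg_cst].
apply: cvgB; last exact: cvg_cst.
apply: (@continuous_comp _ _ _ snd (fun x : 'rV[R]_n => x 0 i)).
  exact: cvg_snd.
exact: coord_continuous.
Qed.

Lemma slide_continuousr n (i : 'I_n) r t : continuous (slide i r t).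
Proof.
move=> x; apply: (@continuousD R _ 'rV[R]_n id); first by move=> ? ?.
apply: (@continuousZr_tmp R _ 'rV[R]_n); apply: continuousM; first exact: cst_continuous.
apply: (@continuousB R R^o 'rV[R]_n); first exact: coord_continuous.
exact: cst_continuous.
Qed.

Lemma is_derive_slide n (i j : 'I_n) r t (f : 'rV[R]_n -> R) x :
  derivable f (slide i r t x) ('e_j) ->
  is_derive x ('e_j) (f \o slide i r t)
    (slide_factor i j t * partial j f (slide i r t x)).
Proof. by apply: is_derive_comp_line => h; exact: slide_line. Qed.

End Slide.

Section UniformLimits.
Variable R : realType.
Local Notation mu := (@lebesgue_measure R).
Local Notation I01 := (`[0, 1 : R]%classic).

Lemma continuous_integrable01 (f : R -> R) :
  continuous f -> mu.-integrable I01 (EFin \o f).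
Proof.
move=> cf; apply: continuous_compact_integrable; first exact: segment_compact.
exact: continuous_subspaceT.
Qed.

Lemma cvg_Rintegral01 (T : Type) (F : set_system T) {FF : Filter F}
    (H : T -> R -> R) (h : R -> R) :
  (\forall x \near F, continuous (H x)) -> continuous h ->
  (forall e : R, 0 < e ->
     \forall x \near F, forall t, I01 t -> `|h t - H x t| <= e) ->
  (\int[mu]_(t in I01) H x t)%R @[x --> F] --> (\int[mu]_(t in I01) h t)%R.
Proof.
move=> cH ch Hh; apply/cvgrPdist_le => e e0.
near=> x.
have cHx : continuous (H x) by near: x.
rewrite -RintegralB//; [|exact: continuous_integrable01..].
have cB : continuous (fun t => h t - H x t).
  by move=> t; apply: cvgB; [exact: ch|exact: cHx].
apply: le_trans (le_normr_Rintegral _ _) _ => //.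
  exact: continuous_integrable01.
have -> : e = (\int[mu]_(t in I01) e)%R.
  rewrite Rintegral_cst//= (@lebesgue_measure_itv R `[0, 1]) /= lte_fin ltr01.
  by rewrite -EFinB/= subr0 mulr1.
apply: le_Rintegral => //.
- apply: continuous_integrable01 => t.
  by apply: cvg_norm; exact: cB.
- by apply: continuous_integrable01; exact: cst_continuous.
- by near: x; exact: Hh.
Unshelve. all: by end_near. Qed.

(** Compactness of the unit interval: for [s] near [t] and [y] near [x], both [K (s, x)] and
    [K (s, y)] are within [e / 2] of [K (t, x)]. *)
Lemma near_uniform01 (T : topologicalType) (K : R * T -> R) (x : T) (e : R) :
  0 < e -> (forall t, {for (t, x), continuous K}) ->
  \forall y \near x, forall t, I01 t -> `|K (t, x) - K (t, y)| <= e.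
Proof.
move=> e0 cK.
have /compact_near_coveringP := @segment_compact R 0 1.
apply => t _.
have e20 : 0 < e / 2 by rewrite divr_gt0.
have /cvgrPdist_lt/(_ _ e20) := cK t.
case=> -[U V] /= [Ut Vx] UV.
exists (U, V) => // -[s y] /= [Us Vy].
have h1 := UV (s, y) (conj Us Vy).
have h2 := UV (s, x) (conj Us (nbhs_singleton Vx)).
move: h1 h2 => /= h1 h2.
rewrite (splitr e) (_ : K (s, x) - K (s, y) =
  (K (t, x) - K (s, y)) - (K (t, x) - K (s, x))); last by ring.
by apply: le_trans (ler_normB _ _) _; apply: lerD; exact: ltW.
Qed.

End UniformLimits.

Section SlideIntegral.
Variables (R : realType) (n : nat) (i : 'I_n) (r : R).
Local Notation mu := (@lebesgue_measure R).
Local Notation I01 := (`[0, 1 : R]%classic).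
Implicit Types (w : R -> R) (u : 'rV[R]_n -> R) (x : 'rV[R]_n).

(** The weight [w] closes the family under differentiation: the partial derivative along ['e_j]
    replaces [u] by [partial j u] and multiplies [w] by [slide_factor i j]. *)
Definition slide_integral w u x : R :=
  (\int[mu]_(t in I01) (w t * u (slide i r t x)))%R.

Lemma slide_integrand_continuous w u : continuous w -> continuous u ->
  continuous (fun q : R * 'rV[R]_n => w q.1 * u (slide i r q.1 q.2)).
Proof.
move=> cw cu q; apply: cvgM.
  by apply: continuous_comp; [exact: cvg_fst|exact: cw].
apply: (@continuous_comp _ _ _ (fun q : R * 'rV[R]_n => slide i r q.1 q.2) u).
  exact: slide_continuous.
exact: cu.
Qed.

Lemma slide_integrand_continuous1 w u x : continuous w -> continuous u ->
  continuous (fun t => w t * u (slide i r t x)).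
Proof.
move=> cw cu t.
apply: (@continuous_comp _ _ _ (fun t => (t, x))
  (fun q : R * 'rV[R]_n => w q.1 * u (slide i r q.1 q.2))).
  by apply: (@cvg_pair _ _ _ _ (nbhs t) (nbhs x)); [exact: cvg_id|exact: cvg_cst].
exact: slide_integrand_continuous.
Qed.

Lemma slide_integral_continuous w u : continuous w -> continuous u ->
  continuous (slide_integral w u).
Proof.
move=> cw cu x; apply: (@cvg_Rintegral01 _ _ (nbhs x) _ (fun y t => w t * u (slide i r t y))).
- by apply: nearW => y; exact: slide_integrand_continuous1.
- exact: slide_integrand_continuous1.
- move=> e e0.
  apply: (near_uniform01 (K := fun q => w q.1 * u (slide i r q.1 q.2)) e0) => t.
  exact: slide_integrand_continuous.
Qed.

Lemma slide_factor_continuous j : continuous (@slide_factor R n i j).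
Proof.
rewrite /slide_factor => t; case: (i == j); first exact: cvg_id.
exact: cst_continuous.
Qed.

(** Mean value theorem along ['e_j]. The point [s] varies with [t], but its bound by [|h|] does not;
    this gives uniformity in [t]. *)
Lemma slide_integrand_mean j w u x (t h : R) :
  (forall y, derivable u y 'e_j) ->
  exists2 s : R, `|s| <= `|h| &
    w t * u (slide i r t (h *: 'e_j + x)) - w t * u (slide i r t x) =
    h * (w t * slide_factor i j t * partial j u (slide i r t (x + s *: 'e_j))).
Proof.
move=> du.
pose P (s : R) := w t * u (slide i r t (x + s *: 'e_j)).
pose dP (s : R) := w t * slide_factor i j t * partial j u (slide i r t (x + s *: 'e_j)).
have dPP (s : R) : is_derive s 1 P (dP s).
  have [d1 d2] := is_derive_slide (du (slide i r t (x + s *: 'e_j))).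
  have := is_derive_line (s := s) d1; rewrite d2 => d3.
  by rewrite /dP -mulrA; exact: is_deriveZ.
have cP a b : {within `[a, b], continuous P}.
  by apply: derivable_within_continuous => s _; have [] := dPP s.
have P0 : P 0 = w t * u (slide i r t x) by rewrite /P scale0r addr0.
have Ph : P h = w t * u (slide i r t (h *: 'e_j + x)) by rewrite /P addrC.
rewrite -P0 -Ph -/(dP _); have [h0|h0] := leP 0 h.
- have [s /[!in_itv]/= /andP[s0 sh] E] :=
    MVT_segment h0 (fun y _ => dPP y) (cP _ _).
  exists s; first by rewrite !ger0_norm.
  by rewrite E subr0 mulrC.
- have [s /[!in_itv]/= /andP[s0 sh] E] :=
    MVT_segment (ltW h0) (fun y _ => dPP y) (cP _ _).
  exists s; first by rewrite (ltr0_norm h0) (ler0_norm sh) lerN2.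
  by rewrite -opprB E sub0r mulrN opprK mulrC.
Qed.

Lemma is_derive_slide_integral j w u x :
  continuous w -> continuous u -> continuous (partial j u) ->
  (forall y, derivable u y 'e_j) ->
  is_derive x 'e_j (slide_integral w u)
    (slide_integral (w \* slide_factor i j) (partial j u) x).
Proof.
move=> cw cu cdu du.
have cw' : continuous (w \* slide_factor i j).
  by move=> t; apply: cvgM; [exact: cw|exact: slide_factor_continuous].
suff L : (fun h : R => h^-1 *: ((slide_integral w u \o shift x) (h *: 'e_j)
    - slide_integral w u x)) @ 0^' -->
    slide_integral (w \* slide_factor i j) (partial j u) x.
  by split; [apply/cvg_ex; eexists; exact: L|exact/cvg_lim/L].
pose H (h t : R) :=
  h^-1 * (w t * u (slide i r t (h *: 'e_j + x)) - w t * u (slide i r t x)).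
have cH h : continuous (H h).
  move=> t; apply: cvgMl_tmp; apply: cvgB; exact: slide_integrand_continuous1.
have -> : (fun h : R => h^-1 *: ((slide_integral w u \o shift x) (h *: 'e_j)
    - slide_integral w u x)) = fun h => (\int[mu]_(t in I01) H h t)%R.
  apply/funext => h /=; rewrite /slide_integral -RintegralB//; last 2 first.
  - by apply: continuous_integrable01; exact: slide_integrand_continuous1.
  - by apply: continuous_integrable01; exact: slide_integrand_continuous1.
  rewrite RintegralZl//; apply: continuous_integrable01.
  move=> t; apply: cvgB; exact: slide_integrand_continuous1.
apply: cvg_Rintegral01 => [||e e0].
- by apply: nearW => h; exact: cH.
- exact: slide_integrand_continuous1.
(* The shift along ['e_j] becomes a parameter, so that uniformity near shift 0 covers the unknown
   mean value points for all [t] at once. *)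
pose K (q : R * R) := (w \* slide_factor i j) q.1 *
  partial j u (slide i r q.1 (x + q.2 *: 'e_j)).
have cK t : {for (t, 0), continuous K}.
  apply: (@continuous_comp _ _ _ (fun q : R * R => (q.1, x + q.2 *: 'e_j))
    (fun q : R * 'rV[R]_n => (w \* slide_factor i j) q.1 *
       partial j u (slide i r q.1 q.2))); last exact: slide_integrand_continuous.
  apply: (@cvg_pair _ _ _ _ (nbhs t) (nbhs (x + 0 *: 'e_j))); first exact: cvg_fst.
  apply: cvgD; first exact: cvg_cst.
  by apply: cvgZr_tmp; exact: cvg_snd.
have := near_uniform01 e0 cK.
case/nbhs_ballP => d /= d0 dK.
near=> h => t t01.
have h0 : h != 0 by near: h; exact: nbhs_dnbhs_neq.
have hd : `|h| < d by near: h; apply: dnbhs0_lt.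
have [s sh E] := slide_integrand_mean w x t h du.
rewrite /H E mulKf//.
have := dK s; rewrite /ball/= sub0r normrN => /(_ (le_lt_trans sh hd) t t01).
by rewrite /K /= scale0r addr0.
Unshelve. all: by end_near. Qed.

Lemma smooth_slide_integral w u : continuous w -> smooth u ->
  smooth (slide_integral w u).
Proof.
move=> cw su l; elim: l w cw u su => [|j l IH] w cw u su.
  split=> [|j x]; first by apply: slide_integral_continuous => //; exact: (su [::]).1.
  by have [] := is_derive_slide_integral x cw (su [::]).1 (su [:: j]).1
    ((su [::]).2 j).
rewrite /=.
have -> : partial j (slide_integral w u) =
    slide_integral (w \* slide_factor i j) (partial j u).
  apply/funext => x.
  by have [] := is_derive_slide_integral x cw (su [::]).1 (su [:: j]).1
    ((su [::]).2 j).
apply: IH; last by move=> l'; exact: (su (j :: l')).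
by move=> t; apply: cvgM; [exact: cw|exact: slide_factor_continuous].
Qed.

Lemma smooth_slide t u : smooth u -> smooth (u \o slide i r t).
Proof.
move=> su.
(* Scalar multiples of [v \o slide i r t] with [v] smooth are stable under partial derivatives; the
   scalar collects the slide factors. *)
have H l : forall c v, smooth v ->
   exists c' v', smooth v' /\ partials l (c \*o (v \o slide i r t)) =
     c' \*o (v' \o slide i r t).
  elim: l => [|j l IH] c v sv; first by exists c, v.
  rewrite /= (_ : partial j _ =
    (c * slide_factor i j t) \*o (partial j v \o slide i r t)).
    by apply: IH => l'; exact: (sv (j :: l')).
  apply/funext => x; rewrite /partial /=.
  have [d1 d2] := is_derive_slide ((sv [::]).2 j (slide i r t x)).
  rewrite (_ : c \*o _ = c *: (v \o slide i r t)); last exact/funext.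
  by rewrite deriveZ// d2 /GRing.scale/= mulrA.
move=> l; have [c [v [sv]]] := H l 1 u su.
have -> : 1 \*o (u \o slide i r t) = u \o slide i r t.
  by apply/funext => x /=; rewrite mul1r.
have cv : continuous (v \o slide i r t).
  move=> x; apply: continuous_comp; last exact: (sv [::]).1.
  exact: slide_continuousr.
move=> ->; split=> [x|j x]; first by apply: continuousM; [exact: cst_continuous|exact: cv].
have [d1 _] := is_derive_slide ((sv [::]).2 j (slide i r t x)).
rewrite (_ : c \*o _ = c *: (v \o slide i r t)); last exact/funext.
exact: derivableZ.
Qed.

(** Integrate the derivative of [u (slide i r t x)] in [t] from 0 to 1; the speed [x 0 i - r] of the
    path factors out. *)
Lemma hadamard u x : smooth u ->
  u x = u (slide i r 0 x) +
        (x 0 i - r) * slide_integral (cst 1) (partial i u) x.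
Proof.
move=> su.
pose P (t : R) := u (slide i r t x).
pose dP (t : R) := (x 0 i - r) * partial i u (slide i r t x).
have dPP (t : R) : is_derive t 1 P (dP t).
  have := @is_derive_comp_line R _ R^o u (fun t => slide i r t x) t 1 'e_i
    (x 0 i - r).
  apply; last exact: (su [::]).2.
  move=> h; rewrite /slide [h%:A]mulr1 -[RHS]addrA -scalerDl; congr (_ + _ *: _).
  by ring.
have cP : continuous P.
  by move=> t; apply: differentiable_continuous; apply/derivable1_diffP; have [] := dPP t.
have cdP : continuous dP.
  apply: (@slide_integrand_continuous1 (cst (x 0 i - r))).
    exact: cst_continuous.
  exact: (su [:: i]).1.
have F : (\int[mu]_(t in I01) (dP t)%:E = (P 1)%:E - (P 0)%:E)%E.
  apply: continuous_FTC2 => //.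
  - exact: continuous_subspaceT.
  - split=> [t _||]; first by have [] := dPP t.
      by apply: cvg_at_right_filter; exact: cP.
    by apply: cvg_at_left_filter; exact: cP.
  - by move=> t _; rewrite derive1E; have [_ ->] := dPP t.
have : P 1 - P 0 = (x 0 i - r) * slide_integral (cst 1) (partial i u) x.
  rewrite -[LHS]/(fine ((P 1)%:E - (P 0)%:E)%E) -F.
  rewrite /slide_integral -RintegralZl//.
    by congr fine; apply: eq_integral => t _; rewrite /dP mul1r.
  apply: continuous_integrable01; apply: slide_integrand_continuous1.
    exact: cst_continuous.
  exact: (su [:: i]).1.
by rewrite /P slide1 => <-; rewrite addrC subrK.
Qed.

End SlideIntegral.

(** * The ring of smooth functions *)

Section SmoothRing.
Variables (R : realType) (n : nat).
Implicit Types f g h : smoothFun R n.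

Let sf_opp f : smoothFun R n := sf_mul (sf_cst n (-1)) f.

Let addA : associative (@sf_add R n).
Proof. by move=> f g h; apply: smoothFunP => x; exact: addrA. Qed.

Let addC : commutative (@sf_add R n).
Proof. by move=> f g; apply: smoothFunP => x; exact: addrC. Qed.

Let add0 : left_id (sf_cst n (0 : R)) (@sf_add R n).
Proof. by move=> f; apply: smoothFunP => x; exact: add0r. Qed.

Let addN : left_inverse (sf_cst n (0 : R)) sf_opp (@sf_add R n).
Proof.
by move=> f; apply: smoothFunP => x; rewrite /smooth_fun /= mulN1r addNr.
Qed.

HB.instance Definition _ := gen_eqMixin (smoothFun R n).
HB.instance Definition _ := gen_choiceMixin (smoothFun R n).
HB.instance Definition _ :=
  GRing.isZmodule.Build (smoothFun R n) addA addC add0 addN.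

Let mulA : associative (@sf_mul R n).
Proof. by move=> f g h; apply: smoothFunP => x; exact: mulrA. Qed.

Let mulC : commutative (@sf_mul R n).
Proof. by move=> f g; apply: smoothFunP => x; exact: mulrC. Qed.

Let mul1 : left_id (sf_cst n (1 : R)) (@sf_mul R n).
Proof. by move=> f; apply: smoothFunP => x; exact: mul1r. Qed.

Let mulDl : left_distributive (@sf_mul R n) (@sf_add R n).
Proof. by move=> f g h; apply: smoothFunP => x; exact: mulrDl. Qed.

HB.instance Definition _ :=
  GRing.Zmodule_isComPzRing.Build (smoothFun R n) mulA mulC mul1 mulDl.

Lemma sfD f g x : smooth_fun (f + g) x = f x + g x. Proof. by []. Qed.

Lemma sfM f g x : smooth_fun (f * g) x = f x * g x. Proof. by []. Qed.

Lemma sfB f g x : smooth_fun (f - g) x = f x - g x.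
Proof. by rewrite sfD; congr (_ + _); exact: mulN1r. Qed.

End SmoothRing.

Section Evaluation.
Variables (R : realType) (A : cinfRing R) (n : nat) (a : 'I_n -> A).

Definition sf_eval (f : smoothFun R n) : A := cinf_op f a.

Fact sf_eval_is_zmod_morphism : zmod_morphism sf_eval.
Proof.
have D f g : sf_eval (f + g) = sf_eval f + sf_eval g.
  exact/esym/Defs.cinf_addE.
by move=> f g; apply: (addIr (sf_eval g)); rewrite -D !subrK.
Qed.

Fact sf_eval_is_monoid_morphism : monoid_morphism sf_eval.
Proof.
split; first exact/esym/Defs.cinf_cstE.
by move=> f g; exact/esym/Defs.cinf_mulE.
Qed.

HB.instance Definition _ := GRing.isZmodMorphism.Build (smoothFun R n) A sf_eval
  sf_eval_is_zmod_morphism.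
HB.instance Definition _ := GRing.isMonoidMorphism.Build (smoothFun R n) A
  sf_eval sf_eval_is_monoid_morphism.

Lemma sf_eval_cst c : sf_eval (sf_cst n c) = c *: (1 : A).
Proof.
rewrite -(rmorph1 sf_eval) -[RHS]/(cinf_scale c (cinf_op _ a)).
rewrite Defs.cinf_scaleE; congr (cinf_op _ _); apply: smoothFunP => x.
exact/esym/mulr1.
Qed.

End Evaluation.

(** * Hadamard's lemma and dependence on variables *)

Section Hadamard.
Variables (R : realType) (n : nat).
Implicit Types (f g c : smoothFun R n) (m : nat) (i : 'I_n).

(** Measures the induction on variables: constant functions for [m = 0], all functions for
    [m = n]. *)
Definition depends_below m (f : 'rV[R]_n -> R) : Prop :=
  forall x y : 'rV[R]_n,
    (forall i : 'I_n, (i < m)%N -> x 0 i = y 0 i) -> f x = f y.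

Lemma depends_below_partial m f i :
  depends_below m f -> depends_below m (partial i f).
Proof.
move=> df x y xy; rewrite /partial /derive.
set u := fun h => h^-1 *: _; set v := fun h => h^-1 *: _; suff -> : u = v by [].
apply/funext => h; rewrite /u /v /=; congr (_ *: (_ - _)); apply: df => // j jm.
by rewrite !mxE xy.
Qed.

(** Here [c] is [f] with coordinate [i] frozen at [r], hence has lost that variable, while the
    quotient [g] acquires no variable beyond those of [f]. *)
Lemma sf_hadamard i (r : R) f : exists c g,
  [/\ f = c + (sf_coord R i - sf_cst n r) * g,
      depends_below i.+1 f -> depends_below i c &
      depends_below i.+1 f -> depends_below i.+1 g].
Proof.
have sg : smooth (slide_integral i r (cst 1) (partial i f)).
  apply: smooth_slide_integral; first by move=> t V; exact: cst_continuous.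
  by move=> l; exact: (svalP f (i :: l)).
exists (exist _ _ (smooth_slide i r 0 (svalP f))), (exist _ _ sg); split.
- apply: smoothFunP => x.
  by rewrite sfD sfM sfB; exact: (hadamard i r x (svalP f)).
- move=> df x y xy; apply: df => j ji; rewrite !slideE !mul0r.
  case: eqVneq => // ij; apply: xy; rewrite ltn_neqAle eq_sym ij.
  exact: ji.
- move=> df x y xy; apply: eq_Rintegral => t _; congr (_ * _).
  have := depends_below_partial i df; apply => j ji; rewrite !slideE (xy i)//.
  by case: ifP => // _; exact: xy.
Qed.

End Hadamard.

(** * Division by polynomials in one variable *)

Section Division.
Variables (R : realType) (n : nat) (C : comPzRingType).
Variables (F G : {rmorphism smoothFun R n -> C}).
Hypothesis FG_cst : forall c, F (sf_cst n c) = G (sf_cst n c).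
Hypothesis FG_coord : forall i, F (sf_coord R i) = G (sf_coord R i).
Variable roots : 'I_n -> seq R.

Definition root_prod i (s : seq R) : smoothFun R n :=
  \prod_(c <- s) (sf_coord R i - sf_cst n c).

Let q i := root_prod i (roots i).

(** Polynomial remainders cancel in [F f - G f], so they need not be recorded. *)
Let divisible f := exists g : 'I_n -> smoothFun R n,
  F f - G f = \sum_i G (q i) * (F (g i) - G (g i)).

Let divisibleD f g : divisible f -> divisible g -> divisible (f + g).
Proof.
move=> [u fu] [v gv]; exists (fun i => u i + v i).
rewrite !rmorphD opprD addrACA fu gv -big_split; apply: eq_bigr => i _ /=.
by rewrite -mulrDr !rmorphD opprD addrACA.
Qed.

Let divisibleM p f : F p = G p -> divisible f -> divisible (p * f).
Proof.
move=> Fp [u fu]; exists (fun i => p * u i).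
rewrite !rmorphM Fp -mulrBr fu mulr_sumr; apply: eq_bigr => i _.
by rewrite !rmorphM Fp -mulrBr mulrCA.
Qed.

Let divisible_fixed f : F f = G f -> divisible f.
Proof.
move=> Ff; exists (fun=> 0); rewrite Ff subrr big1// => i _.
by rewrite !rmorph0 subrr mulr0.
Qed.

Let F_linear i c : F (sf_coord R i - sf_cst n c) = G (sf_coord R i - sf_cst n c).
Proof. by rewrite !rmorphB FG_cst FG_coord. Qed.

Let divisible_q i f : divisible (q i * f).
Proof.
exists (fun j => if j == i then f else 0).
have Fq : F (q i) = G (q i).
  by rewrite !rmorph_prod; apply: eq_bigr => c _; exact: F_linear.
rewrite (bigD1 i)//= eqxx big1 => [|j /negbTE ->].
  by rewrite addr0 !rmorphM Fq mulrBr.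
by rewrite !rmorph0 subrr mulr0.
Qed.

Let divisible_below m (f : smoothFun R n) : depends_below m f -> divisible f.
Proof.
elim: m f => [|m IH] f df.
  rewrite (_ : f = sf_cst n (f 0)); first exact: divisible_fixed.
  by apply: smoothFunP => x; exact: df.
have [nm|mn] := leqP n m.
  apply: IH => x y xy; apply: df => i _; apply: xy.
  exact: leq_trans (ltn_ord i) nm.
pose i := Ordinal mn.
(* Inner induction on the roots: [p] is the product of the linear factors already split off, [s]
   lists those still to come. *)
suff H s p : F p = G p -> p * root_prod i s = q i ->
    forall g : smoothFun R n, depends_below m.+1 g -> divisible (p * g).
  by rewrite -[f]mul1r; apply: (H (roots i)) => //; rewrite ?rmorph1 ?mul1r.
elim: s p => [|c s IHs] p Fp pq g dg.
  by rewrite /root_prod big_nil mulr1 in pq; rewrite pq; exact: divisible_q.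
(* The remainder [u] has one variable less and falls to the outer induction; the quotient [v] meets
   the next root. *)
have [u [v [guv /(_ dg) du /(_ dg) dv]]] := sf_hadamard i c g; rewrite guv.
rewrite mulrDr; apply: divisibleD.
  by apply: divisibleM => //; exact: IH.
rewrite mulrA; apply: IHs => //.
  by rewrite !rmorphM Fp F_linear.
by rewrite -pq /root_prod big_cons mulrA.
Qed.

Lemma sf_division (f : smoothFun R n) : exists g : 'I_n -> smoothFun R n,
  F f - G f = \sum_i G (root_prod i (roots i)) * (F (g i) - G (g i)).
Proof.
apply: (@divisible_below n) => x y xy; congr (smooth_fun f _); apply/rowP => i.
exact: xy.
Qed.

End Division.

(** * Jets *)

Section Jets.
Variables (R : realType) (n : nat).
Implicit Types (f g : smoothFun R n) (i j : 'I_n) (k : nat) (p : 'rV[R]_n).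

Lemma smooth_partial i f : smooth (partial i f).
Proof. by move=> l; exact: (svalP f (i :: l)). Qed.

Definition sf_partial i f : smoothFun R n := exist _ _ (smooth_partial i f).

Let sf_derivable f i x : derivable f x 'e_i.
Proof. exact: (svalP f [::]).2. Qed.

Lemma sf_partialD i f g : sf_partial i (f + g) = sf_partial i f + sf_partial i g.
Proof.
apply: smoothFunP => x; rewrite sfD /smooth_fun /= partialD//;
  exact: sf_derivable.
Qed.

Lemma sf_partialM i f g :
  sf_partial i (f * g) = f * sf_partial i g + g * sf_partial i f.
Proof.
apply: smoothFunP => x; rewrite sfD !sfM /smooth_fun /= partialM//;
  exact: sf_derivable.
Qed.

Lemma sf_partialB i f g : sf_partial i (f - g) = sf_partial i f - sf_partial i g.
Proof. by apply: (addIr (sf_partial i g)); rewrite -sf_partialD !subrK. Qed.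

(** The strict inequality makes [k] the order of vanishing: a root of multiplicity [k] gives
    [flat k], while equality of [k]-jets is [flat k.+1] of the difference. *)
Definition flat k p f : Prop :=
  forall l : seq 'I_n, (size l < k)%N -> partials l f p = 0.

Lemma flatS k p f :
  flat k.+1 p f <-> f p = 0 /\ forall i, flat k p (sf_partial i f).
Proof.
split=> [pf|[fp pf] [|i l] lk]; [|exact: fp|exact: pf].
by split=> [|i l lk]; [exact: (pf [::])|exact: (pf (i :: l))].
Qed.

Lemma flatW k p f : flat k.+1 p f -> flat k p f.
Proof. by move=> pf l lk; apply: pf; exact: ltnW. Qed.

Lemma flatD k p f g : flat k p f -> flat k p g -> flat k p (f + g).
Proof.
elim: k f g => [//|k IH] f g /flatS[f0 pf] /flatS[g0 pg]; apply/flatS; split.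
  by rewrite sfD f0 g0 addr0.
by move=> i; rewrite sf_partialD; exact: IH.
Qed.

Lemma flatM k p f g : flat k p f -> flat k p (f * g).
Proof.
elim: k f g => [//|k IH] f g kf; have /flatS[f0 pf] := kf.
apply/flatS; split=> [|i]; first by rewrite sfM f0 mul0r.
rewrite sf_partialM [g * _]mulrC; apply: flatD; apply: IH => //.
exact: flatW.
Qed.

Lemma flat_zero k p : flat k p 0.
Proof.
elim: k => [//|k IH]; apply/flatS; split=> // i.
by rewrite -(subrr 0) sf_partialB subrr.
Qed.

Lemma flat_sum k p (I : finType) (F : I -> smoothFun R n) :
  (forall t, flat k p (F t)) -> flat k p (\sum_t F t).
Proof.
move=> kF; elim/big_ind: _ => //; first exact: flat_zero.
by move=> f g; exact: flatD.
Qed.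

(** By Leibniz, a derivative of the product is the linear factor times a derivative of [f], covered
    by induction, plus a multiple of [f]. *)
Lemma flat_linear k p i f : flat k p f ->
  flat k.+1 p ((sf_coord R i - sf_cst n (p 0 i)) * f).
Proof.
elim: k f => [|k IH] f kf; apply/flatS; split.
- by rewrite sfM sfB subrr mul0r.
- by [].
- by rewrite sfM sfB subrr mul0r.
- move=> j; rewrite sf_partialM; apply: flatD; last exact: flatM.
  by apply: IH; have /flatS[_] := kf.
Qed.

Lemma flat_root_prod p i (s : seq R) :
  flat (count_mem (p 0 i) s) p (root_prod i s).
Proof.
rewrite /root_prod; elim: s => [//|c s IH]; rewrite big_cons /=.
have [->|_] := eqVneq c (p 0 i); first by rewrite add1n; exact: flat_linear.
by rewrite add0n mulrC; exact: flatM.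
Qed.

Lemma same_jet_flat k p f g : flat k.+1 p (f - g) -> same_jet k p f g.
Proof.
move=> fg l; elim: l k f g fg => [|i l IH] k f g /flatS[fg0 fg] lk.
  by apply/eqP; rewrite -subr_eq0 -[X in X == _]sfB fg0.
case: k fg lk => // k fg lk.
apply: (IH k (sf_partial i f) (sf_partial i g)) => //.
by rewrite -sf_partialB; exact: fg.
Qed.

End Jets.

(** * Separation of elements by jet approximation *)

Lemma natural_closed1 (R : realType) (B : cinfRing R) (b : natural B) :
  near_point_determined B -> natural_open (~` [set b]).
Proof.
move=> hB; suff: open (~` [set b]) by [].
apply: closed_openC; apply: accessible_closed_set1.
exact: hausdorff_accessible.
Qed.

(** If the value at [h] were not [b], the preimage of the complement of [b] would be a jet-open set
    around [h], and some approximant [g] with value [b] would lie in it. *)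
Lemma cinf_eval_eq (R : realType) (B : cinfRing R) (S : Type) (a : S -> B)
    (h : Cinf R S) (b : B) :
  near_point_determined B ->
  (forall m (p : 'I_m -> S -> R) (k : 'I_m -> nat), exists g : Cinf R S,
     cinf_eval a g = b /\ forall j, same_jetS (k j) (p j) g h) ->
  cinf_eval a h = b.
Proof.
move=> hB approx; apply: contrapT => hb.
have := @natural_closed1 R B b hB S a.
move=> /jet_openE[D UD].
have : (cinf_eval a @^-1` (~` [set b])) h by [].
rewrite UD => -[J DJ hJ].
have [g [gb gh]] := approx _ (jet_point (j:=J)) (jet_order (j:=J)).
suff : (cinf_eval a @^-1` (~` [set b])) g by apply.
rewrite UD; exists J => // j.
exact: same_jetS_trans (gh j) (hJ j).
Qed.

Lemma sf_eval_root_prod (R : realType) (B : cinfRing R) n (v : 'I_n -> B) i s :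
  sf_eval v (root_prod i s) = \prod_(c <- s) (v i - c *: (1 : B)).
Proof.
rewrite rmorph_prod; apply: eq_bigr => c _.
by rewrite rmorphB /= sf_eval_cst; congr (_ - _); exact: cinf_op_coord.
Qed.

Theorem proposition8 (R : realType) (A B : cinfRing R)
    (hB : near_point_determined B)
    (phi : {rmorphism A -> B}) (hphi : scalable phi) :
  cinf_morphism (phi : A -> B).
Proof.
move=> n f a.
(* The component ['I_n] of the pairs keeps [s] below injective even if the
   elements [phi (sf_eval a (g i))] coincide. *)
pose S := ('I_n + 'I_n * B)%type.
(* The coordinates are fixed before the jet conditions, on which the quotients [g] depend. Hence
   every element of [B] gets coordinates in advance, and [b] evaluates them to that element. *)
pose b (x : S) : B := match x with inl i => phi (a i) | inr ic => ic.2 end.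
have inlI : injective (inl : 'I_n -> S) by move=> i j [].
have hP : exists m (s : 'I_m -> S) (f' : smoothFun R m),
    factors (fun x => f (coords inl x)) s f' by exists n, inl, f.
pose h : Cinf R S := exist _ _ hP.
have hf : factors h inl f by [].
have <- : cinf_eval b h = cinf_op f (fun i => phi (a i)) by exact: cinf_evalE hf.
apply/esym/(cinf_eval_eq hB) => m p k.
(* Each point contributes its coordinate [inl i] with multiplicity [(k j).+1], the order of flatness
   that equality of [k j]-jets demands. *)
pose roots i := flatten [seq nseq (k j).+1 (p j (inl i)) | j <- enum 'I_m].
have roots_count i j : (k j < count_mem (p j (inl i)) (roots i))%N.
  rewrite /roots count_flatten -map_comp sumnE big_map big_enum.
  rewrite (bigD1 j)//= count_nseq /= eqxx mul1n addSn ltnS.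
  exact: leq_addr.
have FG_cst c : (phi \o sf_eval a) (sf_cst n c) = sf_eval (phi \o a) (sf_cst n c).
  by rewrite /= !sf_eval_cst hphi rmorph1.
have FG_coord i :
    (phi \o sf_eval a) (sf_coord R i) = sf_eval (phi \o a) (sf_coord R i).
  by rewrite /= /sf_eval !cinf_op_coord.
have [g fg] := sf_division FG_cst FG_coord roots f.
pose s (t : 'I_(n + n)) : S := match fintype.split t with
  | inl i => inl i | inr i => inr (i, phi (sf_eval a (g i))) end.
have sl i : s (lshift n i) = inl i by rewrite /s (unsplitK (inl i)).
have sr i : s (rshift n i) = inr (i, phi (sf_eval a (g i))).
  by rewrite /s (unsplitK (inr i)).
have sI : injective s.
  move=> t u; rewrite -(splitK t) -(splitK u).
  by case: (fintype.split t) (fintype.split u) => [i|i] [j|j] /=;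
    rewrite ?sl ?sr // => -[->].
(* A function of the [x] variables, viewed on the [x] and [y] variables together. *)
pose left := sf_pull (@lshift_inj n n) : smoothFun R n -> smoothFun R (n + n).
pose w := \sum_i root_prod (lshift n i) (roots i) *
  (sf_coord R (rshift n i) - left (g i)).
have hleft : factors h s (left f).
  by split=> // x; congr (f _); apply/rowP => i; rewrite !mxE sl.
have h0P : exists m' (s' : 'I_m' -> S) (f' : smoothFun R m'),
    factors (fun x => smooth_fun (left f + w) (coords s x)) s' f'.
  by exists (n + n)%N, s, (left f + w).
pose h0 : Cinf R S := exist _ _ h0P.
have h0f : factors h0 s (left f + w) by [].
have eval_left u : sf_eval (b \o s) (left u) = sf_eval (phi \o a) u.
  rewrite /sf_eval Defs.cinf_op_pull; congr (cinf_op _ _).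
  by apply/funext => i /=; rewrite sl.
exists h0; split=> [|j].
  rewrite (cinf_evalE _ h0f) -[LHS]/(sf_eval _ _) rmorphD /= eval_left.
  (* Split the target into [G f], the value of [left f], and [F f - G f], which the division
     identifies with the value of [w]. *)
  rewrite -[RHS](subrK (sf_eval (phi \o a) f)) addrC; congr (_ + _).
  rewrite [RHS]fg rmorph_sum; apply: eq_bigr => i _.
  rewrite rmorphM rmorphB /= eval_left !sf_eval_root_prod /= sl; congr (_ * (_ - _)).
  by rewrite /sf_eval cinf_op_coord /= sr.
exists (n + n)%N, s, (left f + w), (left f); split=> //.
(* The difference of the two functions is [w], each summand of which contains a product of linear
   factors that is flat enough at [p j]. *)
apply: same_jet_flat; rewrite addrAC subrr add0r; apply: flat_sum => i.
apply: flatM => l lk; apply: flat_root_prod.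
by rewrite mxE sl; exact: leq_trans lk (roots_count i j).
Qed.
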